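(* Let $T$ be a tree, let $\lambda: T\to(0,\infty)$ be a weight, let $1\le p<\infty$, and let $\varphi:T\to T$ be an injective self-map. Then $C_\varphi$ is an isometry on $L^p_\lambda(T)$ if and only if $\varphi$ is surjective and $\frac{\lambda(v)}{\lambda(\varphi(v))}=1$ for every $v\in T$.
   Context: A tree $T$ is a connected, locally finite graph without cycles on a countably infinite vertex set (identified with $T$), with a fixed vertex $o$ called the root, and with no terminal vertices (a terminal vertex is one having only one neighbour). Functions on $T$ are functions on its vertices. For a weight $\lambda:T\to(0,\infty)$ and $1\le p<\infty$, $L^p_\lambda(T)$ is the Banach space of functions $f:T\to\mathbb{C}$ with $\|f\|_p=\big[\sum_{v\in T}|f(v)|^p\lambda(v)\big]^{1/p}<\infty$. For a self-map $\varphi$ of $T$, the composition operator $C_\varphi$ is $C_\varphi f(v)=f(\varphi(v))$. $C_\varphi$ is an isometry on $L^p_\lambda(T)$ if it maps $L^p_\lambda(T)$ into itself and $\|C_\varphi f\|_p=\|f\|_p$ for all $f\in L^p_\lambda(T)$ (surjectivity of $C_\varphi$ is not part of the definition). *)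

(* Defs.v *)
From mathcomp Require Import all_boot all_order all_algebra.
From mathcomp Require Import all_classical all_reals all_analysis.
From mathcomp Require Import complex.

Set Implicit Arguments.
Unset Strict Implicit.
Unset Printing Implicit Defensive.

Import Order.TTheory GRing.Theory Num.Theory.

Local Open Scope classical_set_scope.
Local Open Scope ring_scope.
Local Open Scope complex_scope.

Definition neighbours (V : Type) (adj : rel V) (v : V) : set V :=
  [set w | adj v w].

Definition terminal (V : Type) (adj : rel V) (v : V) : Prop :=
  exists w, neighbours adj v = [set w].

(* Acyclicity is bounded by 2 because, adj being symmetric, an edge u - v
   always yields the closed walk [:: u; v], which is not a cycle of a graph. *)
Record tree := Tree {
  vertex :> countType;
  adj : rel vertex;
  root : vertex;
  vertex_infinite : infinite_set [set: vertex];
  adj_sym : symmetric adj;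
  adj_irrefl : irreflexive adj;
  adj_locally_finite : forall v, finite_set (neighbours adj v);
  adj_connected : forall u v, exists2 s, path adj u s & last u s = v;
  adj_acyclic : forall s, ucycle adj s -> (size s <= 2)%N;
  adj_no_terminal : forall v, ~ terminal adj v
}.

Section WeightedLp.
Variables (R : realType) (T : tree) (lambda : T -> R) (p : R).
Implicit Types (f : T -> R[i]) (phi : T -> T).

(* [Normc.normc] is the modulus of a complex number as an element of [R]. *)
Definition lp_norm f : \bar R :=
  ((\esum_(v in [set: T]) (Normc.normc (f v) `^ p * lambda v)%:E) `^ p^-1)%E.

Definition lp_space : set (T -> R[i]) := [set f | (lp_norm f < +oo)%E].

Definition composition_operator phi f : T -> R[i] := fun v => f (phi v).

Definition lp_isometry (A : (T -> R[i]) -> T -> R[i]) : Prop :=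
  (forall f, lp_space f -> lp_space (A f)) /\
  (forall f, lp_space f -> lp_norm (A f) = lp_norm f).

End WeightedLp.

(* Main.v *)
(** Testing the isometry on the indicator of a point [w] gives
    [\sum_(v in phi^-1 w) lambda v = lambda w].  The right-hand side is
    positive, so the fibre over [w] is nonempty; by injectivity it is a single
    point [v], whence [lambda v = lambda (phi v)].  Conversely, [phi] is then a
    weight-preserving bijection and the norm is reindexed along it. *)
Require Import Defs.
From mathcomp Require Import all_boot all_order all_algebra.
From mathcomp Require Import all_classical all_reals all_analysis.
From mathcomp Require Import complex.

Import Order.TTheory GRing.Theory Num.Theory.

Local Open Scope classical_set_scope.
Local Open Scope ring_scope.

Lemma normc_indic (R : realType) (T : Type) (A : set T) (v : T) :
  Normc.normc (\1_A v : R[i]) = \1_A v.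
Proof.
by rewrite !indicE; case: (v \in A); rewrite ?Normc.normc1 ?Normc.normc0.
Qed.

(** Off [A] the summand is the [p]-th power of 0 times the weight. It vanishes because [p] is
    nonzero; the convention for exponent 0 would give 1. *)
Lemma lp_norm_indic (R : realType) (T : tree) (lambda : T -> R) (p : R)
    (A : set T) : p != 0 ->
  lp_norm lambda p (\1_A) = ((\esum_(v in A) (lambda v)%:E) `^ p^-1)%E.
Proof.
move=> p_neq0; rewrite /lp_norm [in RHS]esum_mkcond; congr (_ `^ _)%E.
apply: eq_esum => v _; rewrite normc_indic indicE; case: (v \in A) => /=.
  by rewrite powR1 mul1r.
by rewrite powR0// mul0r.
Qed.

Lemma composition_operator_indic (R : realType) (T : tree) (phi : T -> T)
    (A : set T) :
  @composition_operator R T phi \1_A = \1_(phi @^-1` A).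
Proof. by apply/funext => v; rewrite /composition_operator !indicE. Qed.

Lemma esum_fiber (R : realType) (T : tree) (lambda : T -> R)
    (lambda_ge0 : forall v, 0 <= lambda v) (p : R) (p_gt0 : 0 < p)
    (phi : T -> T) (w : T) :
  lp_isometry lambda p (@composition_operator R T phi) ->
  (\esum_(v in phi @^-1` [set w]) (lambda v)%:E = (lambda w)%:E)%E.
Proof.
have p_neq0 : p != 0 by rewrite gt_eqF.
move=> [_ /(_ \1_[set w])].
rewrite composition_operator_indic /lp_space /= !lp_norm_indic//.
rewrite esum_set1 ?lee_fin//.
(* The norm of a point indicator is a real number, so the isometry applies; raising to the power [p]
   then undoes the outer exponent [p^-1]. *)
move=> /(_ (ltry _)) /(congr1 (fun x => x `^ p)%E).
rewrite -!poweRrM mulVf// !poweRe1 ?lee_fin//.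
by apply: esum_ge0 => v _; rewrite lee_fin.
Qed.

(** The equality holds in the extended reals, for every [f], including those of infinite norm. *)
Lemma lp_norm_composition (R : realType) (T : tree) (lambda : T -> R) (p : R)
    (phi : T -> T) (f : T -> R[i]) :
  set_bij [set: T] [set: T] phi ->
  (forall v, lambda (phi v) = lambda v) ->
  lp_norm lambda p (composition_operator phi f) = lp_norm lambda p f.
Proof.
move=> phi_bij lambda_phi; rewrite /lp_norm; congr (_ `^ _)%E.
rewrite [RHS](reindex_esum [set: T] [set: T] phi)//.
by apply: eq_esum => v _; rewrite lambda_phi.
Qed.

Theorem theorem3p6 (R : realType) (T : tree) (lambda : T -> R)
    (lambda_gt0 : forall v, 0 < lambda v) (p : R) (p_ge1 : 1 <= p)
    (phi : T -> T) (phi_inj : injective phi) :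
  lp_isometry lambda p (@composition_operator R T phi) <->
  (set_surj [set: T] [set: T] phi /\
   forall v : T, lambda v / lambda (phi v) = 1).
Proof.
have lambda_neq0 v : lambda v != 0 by rewrite gt_eqF.
split=> [phi_iso|[phi_surj lambda_phi]].
  have fiber w := esum_fiber R T lambda (fun v => ltW (lambda_gt0 v)) p
    (lt_le_trans ltr01 p_ge1) phi w phi_iso.
  split=> [w _|v].
    apply: contrapT => w_notin.
    have fiber0 : phi @^-1` [set w] = set0.
      by apply/seteqP; split=> // v phi_v; apply: w_notin; exists v.
    (* An empty fibre has total weight 0, which would force [lambda w = 0]. *)
    have := fiber w; rewrite fiber0 esum_set0 => -[/esym/eqP].
    by rewrite (negbTE (lambda_neq0 w)).
  have fiber1 : phi @^-1` [set phi v] = [set v].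
    by apply/seteqP; split=> [u /phi_inj//|u ->].
  have := fiber (phi v); rewrite fiber1 esum_set1 ?lee_fin ?ltW// => -[->].
  by rewrite divff.
have phi_bij : set_bij [set: T] [set: T] phi.
  by split=> // u v _ _; apply: phi_inj.
have norm_phi f : lp_norm lambda p (composition_operator phi f) =
    lp_norm lambda p f.
  by apply: lp_norm_composition => // v; rewrite (divr1_eq (lambda_phi v)).
(* Since [norm_phi] does not presuppose finiteness, it also shows that [lp_space] is mapped into
   itself. *)
by split=> f //; rewrite /lp_space /= norm_phi.
Qed.
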